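(* Let $\mathbf P$ be a full subcategory of a symmetric monoidal category $\mathbf C=(\mathbf C,\otimes,I)$ such that the functor $-\otimes V\colon\mathbf C\to\mathbf C$ has a left adjoint $\mathbf{cohom}(V,-)$ for every $V\in\mathbf P$. Let $\mathbb O=(X,\Delta_X,\varepsilon_X)$ be a comonoid in $\mathbf C$. Then the isomorphisms $$\vartheta_{V,V,X}\colon\mathrm{Hom}\big(\mathbf{cohom}(V,V),X\big)\cong\mathrm{Hom}\big(V,X\otimes V\big),\qquad V\in\mathbf P,$$ give a fully faithful functor $\mathrm{Corep}_{\mathbf P}(\mathbb O)\hookrightarrow\mathrm{Lcoact}(\mathbb O)$. In other words: a morphism $\omega\colon\mathbf{cohom}(V,V)\to X$ is a corepresentation of $\mathbb O$ on $V\in\mathbf P$ if and only if $\delta=\vartheta(\omega)$ is a coaction of $\mathbb O$ on $V$; and, for corepresentations $\omega,\omega'$ of $\mathbb O$ on $V,V'\in\mathbf P$, a morphism $f\colon V\to V'$ in $\mathbf P$ satisfies $\omega\cdot\mathbf{cohom}(f,\mathrm{id}_V)=\omega'\cdot\mathbf{cohom}(\mathrm{id}_{V'},f)$ if and only if it satisfies $(\mathrm{id}_X\otimes f)\cdot\delta=\delta'\cdot f$ with $\delta=\vartheta(\omega)$, $\delta'=\vartheta(\omega')$. In particular, if the symmetric monoidal category $\mathbf C$ is coclosed, then there is an equivalence between the categories $\mathrm{Corep}_{\mathbf C}(\mathbb O)$ and $\mathrm{Lcoact}(\mathbb O)$.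
   Context: Composition of morphisms is written $f\cdot g$; monoidal categories are treated as strict. The left adjoints assemble into a bifunctor $\mathbf{cohom}\colon\mathbf P^{\mathrm{op}}\times\mathbf C\to\mathbf C$ with isomorphisms $\vartheta=\vartheta_{X,Y,Z}\colon\mathrm{Hom}(\mathbf{cohom}(Y,X),Z)\to\mathrm{Hom}(X,Z\otimes Y)$ natural in $X,Z\in\mathbf C$, $Y\in\mathbf P$. Put $\mathrm{coev}_{Y,X}=\vartheta(\mathrm{id})\colon X\to\mathbf{cohom}(Y,X)\otimes Y$. For $V\in\mathbf P$ put $d_V=\vartheta^{-1}\big((\mathrm{id}\otimes\mathrm{coev}_{V,V})\cdot\mathrm{coev}_{V,V}\big)\colon\mathbf{cohom}(V,V)\to\mathbf{cohom}(V,V)\otimes\mathbf{cohom}(V,V)$ and $v_V=\vartheta^{-1}(\mathrm{id}_V)\colon\mathbf{cohom}(V,V)\to I$; then $\mathbf{coend}(V)=(\mathbf{cohom}(V,V),d_V,v_V)$ is a comonoid in $\mathbf C$. A corepresentation of $\mathbb O$ on $V\in\mathbf P$ is a comonoid morphism $\omega\colon\mathbf{coend}(V)\to\mathbb O$, i.e. $\omega\colon\mathbf{cohom}(V,V)\to X$ with $\Delta_X\cdot\omega=(\omega\otimes\omega)\cdot d_V$ and $\varepsilon_X\cdot\omega=v_V$. $\mathrm{Corep}_{\mathbf P}(\mathbb O)$ has as objects the pairs $(V,\omega)$ and as morphisms $(V,\omega)\to(V',\omega')$ the morphisms $f\colon V\to V'$ in $\mathbf P$ such that $\omega\cdot\mathbf{cohom}(f,\mathrm{id}_V)=\omega'\cdot\mathbf{cohom}(\mathrm{id}_{V'},f)$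 as morphisms $\mathbf{cohom}(V',V)\to X$. A (left) coaction of $\mathbb O$ on $V\in\mathbf C$ is $\delta\colon V\to X\otimes V$ with $(\mathrm{id}_X\otimes\delta)\cdot\delta=(\Delta_X\otimes\mathrm{id}_V)\cdot\delta$ and $(\varepsilon_X\otimes\mathrm{id}_V)\cdot\delta=\mathrm{id}_V$. $\mathrm{Lcoact}(\mathbb O)$ has as objects the pairs $(V,\delta)$ and as morphisms $(V,\delta)\to(V',\delta')$ the morphisms $f\colon V\to V'$ in $\mathbf C$ with $(\mathrm{id}_X\otimes f)\cdot\delta=\delta'\cdot f$. A symmetric monoidal category is coclosed if every $-\otimes V$ has a left adjoint. *)

(* Defs.v *)
From Stdlib Require Import ProofIrrelevance.
From mathcomp Require Import ssreflect ssrbool ssrfun.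

Set Implicit Arguments.
Unset Strict Implicit.
Unset Printing Implicit Defensive.

Declare Scope cat_scope.
Delimit Scope cat_scope with cat.
Local Open Scope cat_scope.
Local Obligation Tactic := idtac.

Record category := Category {
  ob :> Type;
  hom : ob -> ob -> Type;
  idm : forall A, hom A A;
  comp : forall A B D, hom B D -> hom A B -> hom A D;
  comp1m : forall A B (f : hom A B), comp (idm B) f = f;
  compm1 : forall A B (f : hom A B), comp f (idm A) = f;
  compA : forall A B D E (h : hom D E) (g : hom B D) (f : hom A B),
    comp h (comp g f) = comp (comp h g) f }.

Arguments hom {c} A B.
Arguments idm {c} A.
Arguments comp {c A B D} g f.

Notation "A ~> B" := (hom A B) (at level 70, no associativity) : cat_scope.
Notation "g ∘ f" := (comp g f) (at level 40, left associativity) : cat_scope.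

Record iso (C : category) (A B : C) := Iso {
  fwd :> A ~> B;
  bwd : B ~> A;
  bwd_fwd : bwd ∘ fwd = idm A;
  fwd_bwd : fwd ∘ bwd = idm B }.

Definition op_cat (C : category) : category :=
  @Category C (fun A B => B ~> A) (fun A => idm A)
    (fun _ _ _ g f => f ∘ g)
    (fun _ _ f => compm1 f) (fun _ _ f => comp1m f)
    (fun _ _ _ _ h g f => esym (compA f g h)).

Program Definition prod_cat (C D : category) : category :=
  @Category (C * D)%type (fun A B => (A.1 ~> B.1) * (A.2 ~> B.2))%type
    (fun A => (idm A.1, idm A.2))
    (fun _ _ _ g f => (g.1 ∘ f.1, g.2 ∘ f.2)) _ _ _.
Next Obligation. by move=> C D A B [f g] /=; rewrite !comp1m. Qed.
Next Obligation. by move=> C D A B [f g] /=; rewrite !compm1. Qed.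
Next Obligation. by move=> *; rewrite /= !compA. Qed.

Definition full_subcat (C : category) (P : C -> Prop) : category :=
  @Category {V : C | P V} (fun V W => sval V ~> sval W)
    (fun V => idm (sval V)) (fun _ _ _ g f => g ∘ f)
    (fun _ _ f => comp1m f) (fun _ _ f => compm1 f)
    (fun _ _ _ _ h g f => compA h g f).

Record functor (C D : category) := Functor {
  fobj :> C -> D;
  fmap : forall A B, A ~> B -> fobj A ~> fobj B;
  fmap1 : forall A, fmap (idm A) = idm (fobj A);
  fmapM : forall A B E (g : B ~> E) (f : A ~> B),
    fmap (g ∘ f) = fmap g ∘ fmap f }.

Arguments fmap {C D} f {A B} : rename.

Definition id_functor (C : category) : functor C C :=
  @Functor C C (fun A => A) (fun _ _ f => f)
    (fun _ => erefl) (fun _ _ _ _ _ => erefl).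

Program Definition comp_functor (C D E : category)
    (G : functor D E) (F : functor C D) : functor C E :=
  @Functor C E (fun A => G (F A)) (fun _ _ f => fmap G (fmap F f)) _ _.
Next Obligation. by move=> *; rewrite /= !fmap1. Qed.
Next Obligation. by move=> *; rewrite /= !fmapM. Qed.

Record nat_iso (C D : category) (F G : functor C D) := NatIso {
  component :> forall A, iso (F A) (G A);
  nat_iso_natural : forall A B (f : A ~> B),
    component B ∘ fmap F f = fmap G f ∘ component A }.

Definition fully_faithful (C D : category) (F : functor C D) : Prop :=
  forall A B, bijective (fun f : A ~> B => fmap F f).

Record equivalence (C D : category) := Equivalence {
  equiv_fun :> functor C D;
  equiv_inv : functor D C;
  equiv_unit : nat_iso (comp_functor equiv_inv equiv_fun) (id_functor C);
  equiv_counit : nat_iso (comp_functor equiv_fun equiv_inv) (id_functor D) }.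

Definition equivalent_cats (C D : category) : Prop := inhabited (equivalence C D).

(** [transp] is the bijection Hom(F X, Z) -> Hom(X, G Z), where F is [ladj]. *)
Record left_adjoint (C D : category) (G : functor D C) := LeftAdjoint {
  ladj :> functor C D;
  transp : forall X Z, ladj X ~> Z -> X ~> G Z;
  untransp : forall X Z, X ~> G Z -> ladj X ~> Z;
  transpK : forall X Z, cancel (@transp X Z) (@untransp X Z);
  untranspK : forall X Z, cancel (@untransp X Z) (@transp X Z);
  transp_natural : forall X X' Z Z' (g : X' ~> X) (h : Z ~> Z') (u : ladj X ~> Z),
    transp (h ∘ u ∘ fmap ladj g) = fmap G h ∘ transp u ∘ g }.

Definition bimap (C : category) (T : functor (prod_cat C C) C)
    (A B A' B' : C) (f : A ~> A') (g : B ~> B') : T (A, B) ~> T (A', B') :=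
  fmap T ((f, g) : @hom (prod_cat C C) (A, B) (A', B')).

(** The associativity and unit constraints are explicit: strictness is not
    assumed, and strict categories are the case where they are identities. *)
Record symmonoidal := SymMonoidal {
  smcat :> category;
  tens : functor (prod_cat smcat smcat) smcat;
  unit_ob : smcat;
  assoc : forall A B D, iso (tens (tens (A, B), D)) (tens (A, tens (B, D)));
  lunit : forall A, iso (tens (unit_ob, A)) A;
  runit : forall A, iso (tens (A, unit_ob)) A;
  braid : forall A B, tens (A, B) ~> tens (B, A);
  assoc_natural : forall A B D A' B' D' (f : A ~> A') (g : B ~> B') (h : D ~> D'),
    assoc A' B' D' ∘ bimap tens (bimap tens f g) h
      = bimap tens f (bimap tens g h) ∘ assoc A B D;
  lunit_natural : forall A B (f : A ~> B),
    lunit B ∘ bimap tens (idm unit_ob) f = f ∘ lunit A;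
  runit_natural : forall A B (f : A ~> B),
    runit B ∘ bimap tens f (idm unit_ob) = f ∘ runit A;
  braid_natural : forall A B A' B' (f : A ~> A') (g : B ~> B'),
    braid A' B' ∘ bimap tens f g = bimap tens g f ∘ braid A B;
  triangle : forall A B,
    bimap tens (idm A) (lunit B) ∘ assoc A unit_ob B
      = bimap tens (runit A) (idm B);
  pentagon : forall A B D E,
    assoc A B (tens (D, E)) ∘ assoc (tens (A, B)) D E
      = bimap tens (idm A) (assoc B D E) ∘ assoc A (tens (B, D)) E
          ∘ bimap tens (assoc A B D) (idm E);
  hexagon : forall A B D,
    assoc B D A ∘ braid A (tens (B, D)) ∘ assoc A B D
      = bimap tens (idm B) (braid A D) ∘ assoc B A D
          ∘ bimap tens (braid A B) (idm D);
  braidK : forall A B, braid B A ∘ braid A B = idm (tens (A, B)) }.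

Arguments unit_ob {s}.
Arguments assoc {s} A B D.
Arguments lunit {s} A.
Arguments runit {s} A.
Arguments braid {s} A B.

Notation "A ⊗ B" := (fobj (tens _) (@pair (ob _) (ob _) A B))
  (at level 35, right associativity) : cat_scope.
Notation "f ⊗ₘ g" := (bimap (tens _) f g)
  (at level 35, right associativity) : cat_scope.

Section SymMonoidalTheory.

Context {C : symmonoidal}.

Lemma tens1 (A B : C) : idm A ⊗ₘ idm B = idm (A ⊗ B).
Proof. exact: (fmap1 (tens C) (A, B)). Qed.

Lemma tensM (A B D A' B' D' : C) (g : B ~> D) (f : A ~> B)
    (g' : B' ~> D') (f' : A' ~> B') :
  (g ∘ f) ⊗ₘ (g' ∘ f') = (g ⊗ₘ g') ∘ (f ⊗ₘ f').
Proof.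
exact: (fmapM (tens C)
  ((g, g') : @hom (prod_cat C C) (B, B') (D, D'))
  ((f, f') : @hom (prod_cat C C) (A, A') (B, B'))).
Qed.

Lemma tens_comp1 (A B D E : C) (g : B ~> D) (f : A ~> B) :
  (g ∘ f) ⊗ₘ idm E = (g ⊗ₘ idm E) ∘ (f ⊗ₘ idm E).
Proof. by rewrite -tensM comp1m. Qed.

Lemma tens_1comp (A B D E : C) (g : B ~> D) (f : A ~> B) :
  idm E ⊗ₘ (g ∘ f) = (idm E ⊗ₘ g) ∘ (idm E ⊗ₘ f).
Proof. by rewrite -tensM comp1m. Qed.

Lemma tens_interchange (A B A' B' : C) (f : A ~> A') (g : B ~> B') :
  (f ⊗ₘ idm B') ∘ (idm A ⊗ₘ g) = (idm A' ⊗ₘ g) ∘ (f ⊗ₘ idm B).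
Proof. by rewrite -!tensM !comp1m !compm1. Qed.

Lemma assoc_bwd_natural (A B D A' B' D' : C)
    (f : A ~> A') (g : B ~> B') (h : D ~> D') :
  bwd (assoc A' B' D') ∘ (f ⊗ₘ (g ⊗ₘ h))
    = ((f ⊗ₘ g) ⊗ₘ h) ∘ bwd (assoc A B D).
Proof.
rewrite -[LHS]compm1 -(fwd_bwd (assoc A B D)) compA -(compA (bwd _)).
by rewrite -assoc_natural !compA bwd_fwd comp1m.
Qed.

Lemma iso_epi (A B D : C) (e : iso A B) (f g : B ~> D) : f ∘ e = g ∘ e -> f = g.
Proof.
by move=> h; rewrite -[f]compm1 -[g]compm1 -(fwd_bwd e) !compA h.
Qed.

Lemma iso_mono (A B D : C) (e : iso A B) (f g : D ~> A) : e ∘ f = e ∘ g -> f = g.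
Proof.
by move=> h; rewrite -[f]comp1m -[g]comp1m -(bwd_fwd e) -!compA h.
Qed.

Lemma unit_tens_inj (A B : C) (f g : A ~> B) :
  idm unit_ob ⊗ₘ f = idm unit_ob ⊗ₘ g -> f = g.
Proof.
by move=> h; apply: (iso_epi (e := lunit A)); rewrite -!lunit_natural h.
Qed.

Lemma assocT_epi (A B D E F : C) (f g : (A ⊗ (B ⊗ D)) ⊗ E ~> F) :
  f ∘ (assoc A B D ⊗ₘ idm E) = g ∘ (assoc A B D ⊗ₘ idm E) -> f = g.
Proof.
move=> h; rewrite -[f]compm1 -[g]compm1 -tens1 -(fwd_bwd (assoc A B D)).
by rewrite tens_comp1 !compA h.
Qed.

Lemma lunit_tens (A B : C) :
  lunit A ⊗ₘ idm B = lunit (A ⊗ B) ∘ assoc unit_ob A B.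
Proof.
apply: unit_tens_inj; apply: (iso_epi (e := assoc _ _ _)).
apply: assocT_epi.
rewrite -assoc_natural -compA -tens_comp1 triangle assoc_natural.
by rewrite tens1 -triangle -compA pentagon !compA -tens_1comp.
Qed.

Lemma pentagon_bwd (A B D E : C) :
  (assoc A B D ⊗ₘ idm E) ∘ bwd (assoc (A ⊗ B) D E) ∘ bwd (assoc A B (D ⊗ E))
    = bwd (assoc A (B ⊗ D) E) ∘ (idm A ⊗ₘ bwd (assoc B D E)).
Proof.
apply: (iso_epi (e := assoc A B (D ⊗ E))).
apply: (iso_epi (e := assoc (A ⊗ B) D E)).
rewrite -!compA (compA (bwd (assoc A B _))) bwd_fwd comp1m bwd_fwd compm1.
rewrite pentagon !compA -(compA (bwd _)) -tens_1comp bwd_fwd tens1 compm1.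
by rewrite bwd_fwd comp1m.
Qed.

End SymMonoidalTheory.

Program Definition tensr (C : symmonoidal) (V : C) : functor C C :=
  @Functor C C (fun Z => Z ⊗ V) (fun _ _ f => f ⊗ₘ idm V) _ _.
Next Obligation. move=> *; exact: tens1. Qed.
Next Obligation. move=> *; exact: tens_comp1. Qed.

Definition coclosed (C : symmonoidal) : Type := forall V : C, left_adjoint (tensr V).

Record comonoid (C : symmonoidal) := Comonoid {
  como_ob :> C;
  comul : como_ob ~> como_ob ⊗ como_ob;
  counit : como_ob ~> unit_ob;
  comulA : assoc _ _ _ ∘ (comul ⊗ₘ idm _) ∘ comul = (idm _ ⊗ₘ comul) ∘ comul;
  counitl : lunit _ ∘ (counit ⊗ₘ idm _) ∘ comul = idm como_ob;
  counitr : runit _ ∘ (idm _ ⊗ₘ counit) ∘ comul = idm como_ob }.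

Arguments comul {C} c.
Arguments counit {C} c.

Definition is_comonoid_mor (C : symmonoidal) (A B : comonoid C) (w : A ~> B) : Prop :=
  comul B ∘ w = (w ⊗ₘ w) ∘ comul A /\ counit B ∘ w = counit A.

Definition is_coaction (C : symmonoidal) (O : comonoid C) (V : C)
    (delta : V ~> O ⊗ V) : Prop :=
  (idm O ⊗ₘ delta) ∘ delta = assoc _ _ _ ∘ (comul O ⊗ₘ idm V) ∘ delta /\
  lunit V ∘ (counit O ⊗ₘ idm V) ∘ delta = idm V.

Definition is_coaction_mor (C : symmonoidal) (O : comonoid C) (V V' : C)
    (delta : V ~> O ⊗ V) (delta' : V' ~> O ⊗ V') (f : V ~> V') : Prop :=
  (idm O ⊗ₘ f) ∘ delta = delta' ∘ f.

Record coaction (C : symmonoidal) (O : comonoid C) := Coaction {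
  coact_ob : C;
  coact : coact_ob ~> O ⊗ coact_ob;
  coactP : is_coaction coact }.

Lemma sig_eq (T : Type) (P : T -> Prop) (u v : {x | P x}) : sval u = sval v -> u = v.
Proof.
case: u v => x hx [y hy] /= exy; subst y; congr exist.
exact: proof_irrelevance.
Qed.

Program Definition Lcoact (C : symmonoidal) (O : comonoid C) : category :=
  @Category (coaction O)
    (fun A B => {f : coact_ob A ~> coact_ob B | is_coaction_mor (coact A) (coact B) f})
    (fun A => exist _ (idm _) _)
    (fun _ _ _ g f => exist _ (sval g ∘ sval f) _) _ _ _.
Next Obligation. by move=> *; rewrite /= /is_coaction_mor tens1 comp1m compm1. Qed.
Next Obligation.
move=> C O A B D [g hg] [f hf] /=; rewrite /is_coaction_mor in hg hf *.
by rewrite tens_1comp -compA hf !compA hg.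
Qed.
Next Obligation. by move=> C O A B f; apply: sig_eq; rewrite /= comp1m. Qed.
Next Obligation. by move=> C O A B f; apply: sig_eq; rewrite /= compm1. Qed.
Next Obligation. by move=> *; apply: sig_eq; rewrite /= compA. Qed.

Section Cohom.

Variables (C : symmonoidal) (P : C -> Prop).
Variable L : forall V : full_subcat P, left_adjoint (tensr (sval V)).

Definition theta (X : C) (Y : full_subcat P) (Z : C) : L Y X ~> Z -> X ~> Z ⊗ sval Y :=
  @transp _ _ _ (L Y) X Z.

Definition theta_inv (X : C) (Y : full_subcat P) (Z : C) : X ~> Z ⊗ sval Y -> L Y X ~> Z :=
  @untransp _ _ _ (L Y) X Z.

Definition coev (Y : full_subcat P) (X : C) : X ~> L Y X ⊗ sval Y :=
  theta (idm (L Y X)).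

Lemma thetaK (X : C) (Y : full_subcat P) (Z : C) :
  cancel (@theta X Y Z) (@theta_inv X Y Z).
Proof. exact: transpK. Qed.

Lemma theta_invK (X : C) (Y : full_subcat P) (Z : C) :
  cancel (@theta_inv X Y Z) (@theta X Y Z).
Proof. exact: untranspK. Qed.

Lemma theta_inj (X : C) (Y : full_subcat P) (Z : C) : injective (@theta X Y Z).
Proof. exact: can_inj (@thetaK X Y Z). Qed.

Lemma theta_comp (X : C) (Y : full_subcat P) (Z Z' : C)
    (h : Z ~> Z') (u : L Y X ~> Z) :
  theta (h ∘ u) = (h ⊗ₘ idm _) ∘ theta u.
Proof.
have := transp_natural (idm X) h u; rewrite fmap1 !compm1; exact.
Qed.

Lemma theta_fmap (X X' : C) (Y : full_subcat P) (Z : C)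
    (g : X' ~> X) (u : L Y X ~> Z) :
  theta (u ∘ fmap (L Y) g) = theta u ∘ g.
Proof. have := transp_natural g (idm Z) u; rewrite comp1m fmap1 comp1m; exact. Qed.

Lemma thetaE (X : C) (Y : full_subcat P) (Z : C) (u : L Y X ~> Z) :
  theta u = (u ⊗ₘ idm _) ∘ coev Y X.
Proof. by rewrite /coev -theta_comp compm1. Qed.

(** The action of cohom in its contravariant variable is the one forced by
    naturality of [theta] in that variable (see [theta_natural]). *)
Definition cohom_mor (Y Y' : full_subcat P) (X X' : C)
    (f : Y ~> Y') (g : X ~> X') : L Y' X ~> L Y X' :=
  fmap (L Y) g ∘ theta_inv ((idm (L Y X) ⊗ₘ f) ∘ coev Y X).

Lemma theta_cohom_mor (Y Y' : full_subcat P) (X X' Z : C)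
    (f : Y ~> Y') (g : X ~> X') (u : L Y X' ~> Z) :
  theta (u ∘ cohom_mor f g) = (idm Z ⊗ₘ f) ∘ theta u ∘ g.
Proof.
rewrite /cohom_mor compA theta_comp theta_invK compA tens_interchange.
by rewrite -compA -thetaE theta_fmap compA.
Qed.

Program Definition cohom : functor (prod_cat (op_cat (full_subcat P)) C) C :=
  @Functor (prod_cat (op_cat (full_subcat P)) C) C (fun YX => L YX.1 YX.2)
    (fun _ _ fg => cohom_mor fg.1 fg.2) _ _.
Next Obligation.
move=> [Y X] /=; apply: theta_inj.
by rewrite -[cohom_mor _ _]comp1m theta_cohom_mor tens1 comp1m compm1.
Qed.
Next Obligation.
move=> [Y X] [Y' X'] [Y'' X''] [f' g'] [f g] /=; apply: theta_inj.
rewrite theta_cohom_mor -[cohom_mor (_ ∘ _) _]comp1m theta_cohom_mor.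
rewrite -[cohom_mor f' g']comp1m theta_cohom_mor.
by rewrite tens_1comp !compA.
Qed.

(** [cohom_map f g] is cohom(f, g) : cohom(Y', X) -> cohom(Y, X'). *)
Definition cohom_map (Y Y' : full_subcat P) (X X' : C)
    (f : Y ~> Y') (g : X ~> X') : cohom (Y', X) ~> cohom (Y, X') :=
  fmap cohom ((f, g) : @hom (prod_cat (op_cat (full_subcat P)) C) (Y', X) (Y, X')).

Lemma theta_natural (Y Y' : full_subcat P) (X X' Z Z' : C)
    (f : Y ~> Y') (g : X ~> X') (h : Z ~> Z') (u : cohom (Y, X') ~> Z) :
  theta (h ∘ u ∘ cohom_map f g) = (h ⊗ₘ f) ∘ theta u ∘ g.
Proof. by rewrite theta_cohom_mor theta_comp compA -tensM comp1m compm1. Qed.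

Definition coend_comul (V : full_subcat P) :
    cohom (V, sval V) ~> cohom (V, sval V) ⊗ cohom (V, sval V) :=
  theta_inv (bwd (assoc _ _ _) ∘ (idm _ ⊗ₘ coev V (sval V)) ∘ coev V (sval V)).

Definition coend_counit (V : full_subcat P) : cohom (V, sval V) ~> unit_ob :=
  theta_inv (bwd (lunit (sval V))).

Lemma coend_comulE (V : full_subcat P) :
  (coend_comul V ⊗ₘ idm _) ∘ coev V (sval V)
    = bwd (assoc _ _ _) ∘ (idm _ ⊗ₘ coev V (sval V)) ∘ coev V (sval V).
Proof. by rewrite -thetaE theta_invK. Qed.

Lemma coend_counitE (V : full_subcat P) :
  (coend_counit V ⊗ₘ idm _) ∘ coev V (sval V) = bwd (lunit (sval V)).
Proof. by rewrite -thetaE theta_invK. Qed.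

Program Definition coend (V : full_subcat P) : comonoid C :=
  @Comonoid C (cohom (V, sval V)) (coend_comul V) (coend_counit V) _ _ _.
Next Obligation.
move=> V; apply: theta_inj; rewrite !thetaE !tens_comp1.
rewrite -!compA !coend_comulE !compA.
rewrite -(compA (assoc _ _ _ ⊗ₘ _)) -assoc_bwd_natural tens1.
rewrite -assoc_bwd_natural.
rewrite -!compA !(compA (coend_comul V ⊗ₘ _)) tens_interchange.
rewrite !(compA (idm _ ⊗ₘ (coend_comul V ⊗ₘ _))) -tens_1comp.
rewrite -!compA coend_comulE !compA.
rewrite !tens_1comp !compA -pentagon_bwd.
rewrite -2!(compA _ (idm _ ⊗ₘ coev _ _)) -!compA.
by rewrite (compA (bwd _) (idm _ ⊗ₘ (idm _ ⊗ₘ _))) assoc_bwd_natural tens1 !compA.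
Qed.
Next Obligation.
move=> V; apply: theta_inj; rewrite !thetaE !tens_comp1 tens1 comp1m.
rewrite -!compA coend_comulE !compA.
rewrite -(compA (lunit _ ⊗ₘ _)) -assoc_bwd_natural tens1.
rewrite -!compA (compA (coend_counit V ⊗ₘ _)) tens_interchange -!compA.
rewrite coend_counitE lunit_tens -!compA (compA (assoc _ _ _)) fwd_bwd comp1m.
by rewrite compA lunit_natural -compA fwd_bwd compm1.
Qed.
Next Obligation.
move=> V; apply: theta_inj; rewrite !thetaE !tens_comp1 tens1 comp1m.
rewrite -!compA coend_comulE !compA.
rewrite -(compA (runit _ ⊗ₘ _)) -assoc_bwd_natural.
rewrite -!compA (compA (idm _ ⊗ₘ (coend_counit V ⊗ₘ _))) -tens_1comp.
rewrite coend_counitE -triangle -!compA (compA (assoc _ _ _)) fwd_bwd comp1m.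
by rewrite compA -tens_1comp fwd_bwd tens1 comp1m.
Qed.

Definition is_corep (O : comonoid C) (V : full_subcat P)
    (w : cohom (V, sval V) ~> O) : Prop :=
  @is_comonoid_mor C (coend V) O w.

Definition is_corep_mor (O : comonoid C) (V V' : full_subcat P)
    (w : cohom (V, sval V) ~> O) (w' : cohom (V', sval V') ~> O)
    (f : V ~> V') : Prop :=
  w ∘ cohom_map f (idm (sval V)) = w' ∘ cohom_map (idm V') (f : sval V ~> sval V').

Record corep (O : comonoid C) := Corepresentation {
  corep_ob : full_subcat P;
  corep_map : cohom (corep_ob, sval corep_ob) ~> O;
  corepP : is_corep corep_map }.

Lemma is_corep_mor1 (O : comonoid C) (V : full_subcat P)
    (w : cohom (V, sval V) ~> O) : is_corep_mor w w (idm V).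
Proof. by []. Qed.

Lemma is_corep_mor_comp (O : comonoid C) (V V' V'' : full_subcat P)
    (w : cohom (V, sval V) ~> O) (w' : cohom (V', sval V') ~> O)
    (w'' : cohom (V'', sval V'') ~> O) (g : V' ~> V'') (f : V ~> V') :
  is_corep_mor w' w'' g -> is_corep_mor w w' f -> is_corep_mor w w'' (g ∘ f).
Proof.
move=> hg hf; apply: theta_inj.
have {hg} := congr1 (@theta _ _ _) hg; have {hf} := congr1 (@theta _ _ _) hf.
rewrite !theta_cohom_mor /= !tens1 !comp1m !compm1 => hf hg.
by rewrite tens_1comp -compA hf !compA hg.
Qed.

Program Definition Corep (O : comonoid C) : category :=
  @Category (corep O)
    (fun A B => {f : corep_ob A ~> corep_ob B
                   | is_corep_mor (corep_map A) (corep_map B) f})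
    (fun A => exist _ (idm _) (is_corep_mor1 (corep_map A)))
    (fun _ _ _ g f => exist _ (sval g ∘ sval f)
                        (is_corep_mor_comp (proj2_sig g) (proj2_sig f))) _ _ _.
Next Obligation. by move=> O A B f; apply: sig_eq; rewrite /= comp1m. Qed.
Next Obligation. by move=> O A B f; apply: sig_eq; rewrite /= compm1. Qed.
Next Obligation. by move=> *; apply: sig_eq; rewrite /= compA. Qed.

(** The functor (V, w) |-> (V, theta w), f |-> f, given that [theta] sends
    corepresentations to coactions and that corepresentation morphisms are
    coaction morphisms. *)
Section ThetaFunctor.

Variable O : comonoid C.
Hypothesis theta_coaction : forall (V : full_subcat P) (w : cohom (V, sval V) ~> O),
  is_corep w -> is_coaction (theta w).
Hypothesis theta_coaction_mor : forall (V V' : full_subcat P)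
    (w : cohom (V, sval V) ~> O) (w' : cohom (V', sval V') ~> O) (f : V ~> V'),
  is_corep w -> is_corep w' ->
  is_corep_mor w w' f -> is_coaction_mor (theta w) (theta w') f.

Program Definition theta_functor : functor (Corep O) (Lcoact O) :=
  @Functor (Corep O) (Lcoact O)
    (fun A => Coaction (theta_coaction (corepP A)))
    (fun A B f => exist _ (sval f)
       (theta_coaction_mor (corepP A) (corepP B) (proj2_sig f))) _ _.
Next Obligation. by move=> A; apply: sig_eq. Qed.
Next Obligation. by move=> *; apply: sig_eq. Qed.

End ThetaFunctor.

End Cohom.

Definition whole (C : category) : C -> Prop := fun _ => True.

Definition coclosed_adjoints (C : symmonoidal) (cc : coclosed C) :
    forall V : full_subcat (@whole C), left_adjoint (tensr (sval V)) :=
  fun V => cc (sval V).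

(* Main.v *)
From mathcomp Require Import ssreflect ssrbool ssrfun.
Require Import Defs.
Local Open Scope cat_scope.
Local Obligation Tactic := idtac.

(** The bijection [theta] is composition with the universal coaction: it sends
    [w] to [(w ⊗ id) ∘ coev].  Being injective, it lets every equation between
    maps out of a [cohom (V, W)] be tested after transposition.  The
    comultiplication and the counit of [coend V] are defined by their
    transposes, so the two axioms of a comonoid morphism [w] transpose to the
    coassociativity and the counit axiom of [theta w], up to cancelling the
    associator and the left unitor ([theta_tens_coend_comul],
    [corep_iff_coaction]).  Likewise, by naturality of [theta] in all variables,
    the equation [w ∘ cohom(f, id) = w' ∘ cohom(id, f)] transposes to
    [(id ⊗ f) ∘ theta w = theta w' ∘ f] ([corep_mor_iff_coaction_mor]).

    The two kinds of morphisms over [theta] are therefore the same maps [f], so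
    the functor that [theta] induces is fully faithful.  When every
    functor [- ⊗ V] has a left adjoint, each coaction [delta] is the transpose of
    [theta_inv delta], so that this functor is also essentially surjective, with
    an explicit choice of preimages, and hence an equivalence
    ([equivalent_of_split_ess_surj]). *)

(** * Functors with an explicit inverse on hom-sets *)

(** The inverse on hom-sets and the preimages of objects are data here, so that
    the quasi-inverse is built without a choice principle. *)
Lemma equivalent_of_split_ess_surj (C D : category) (F : functor C D)
    (finv : forall A B : C, F A ~> F B -> A ~> B)
    (fmapK : forall A B : C, cancel (fun f : A ~> B => fmap F f) (finv A B))
    (finvK : forall A B : C, cancel (finv A B) (fun f : A ~> B => fmap F f))
    (G : D -> C) (e : forall B : D, iso (F (G B)) B) :
  equivalent_cats C D.
Proof.
have F_inj (A B : C) (f g : A ~> B) : fmap F f = fmap F g -> f = g.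
  exact: (can_inj (fmapK A B)).
(* The action on morphisms is conjugation by [e], lifted along [F]. *)
pose Gmap (A B : D) (g : A ~> B) : G A ~> G B :=
  finv _ _ (bwd (e B) ∘ g ∘ fwd (e A)).
have FGmap (A B : D) (g : A ~> B) :
    fmap F (Gmap A B g) = bwd (e B) ∘ g ∘ fwd (e A).
  exact: finvK.
have Gmap1 (A : D) : Gmap A A (idm A) = idm (G A).
  by apply: F_inj; rewrite FGmap compm1 bwd_fwd fmap1.
have GmapM (A B E : D) (g : B ~> E) (f : A ~> B) :
    Gmap A E (g ∘ f) = Gmap B E g ∘ Gmap A B f.
  apply: F_inj; rewrite fmapM !FGmap !compA.
  by rewrite -(compA _ (fwd (e B))) fwd_bwd compm1.
pose GF := @Functor D C G Gmap Gmap1 GmapM.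
have lift_bwdK (A : C) :
    finv _ _ (bwd (e (F A))) ∘ finv _ _ (fwd (e (F A))) = idm (G (F A)).
  by apply: F_inj; rewrite fmapM !finvK bwd_fwd fmap1.
have lift_fwdK (A : C) :
    finv _ _ (fwd (e (F A))) ∘ finv _ _ (bwd (e (F A))) = idm A.
  by apply: F_inj; rewrite fmapM !finvK fwd_bwd fmap1.
have unit_natural (A B : C) (f : A ~> B) :
    finv _ _ (fwd (e (F B))) ∘ Gmap _ _ (fmap F f)
      = f ∘ finv _ _ (fwd (e (F A))).
  by apply: F_inj; rewrite !fmapM FGmap !finvK !compA fwd_bwd comp1m.
have counit_natural (A B : D) (g : A ~> B) :
    fwd (e B) ∘ fmap F (Gmap A B g) = g ∘ fwd (e A).
  by rewrite FGmap !compA fwd_bwd comp1m.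
constructor; apply: (@Equivalence C D F GF).
- exact: (@NatIso _ _ (comp_functor GF F) (id_functor C)
    (fun A => @Iso C (G (F A)) A _ _ (lift_bwdK A) (lift_fwdK A)) unit_natural).
- exact: (@NatIso _ _ (comp_functor F GF) (id_functor D) e counit_natural).
Qed.

(** * Transposing corepresentations *)

Section Transposition.

Context {C : symmonoidal} (O : comonoid C) {P : C -> Prop}.
Context (L : forall V : full_subcat P, left_adjoint (tensr (proj1_sig V))).

(** Each of the two factors [w] absorbs one of the two copies of [coev] in the
    transpose of [coend_comul], which turns it into a copy of [theta w]. *)
Lemma theta_tens_coend_comul (V : full_subcat P) (Z : C)
    (w : cohom L (V, proj1_sig V) ~> Z) :
  theta ((w ⊗ₘ w) ∘ coend_comul L V)
    = bwd (assoc _ _ _) ∘ (idm _ ⊗ₘ theta w) ∘ theta w.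
Proof.
rewrite theta_comp /coend_comul theta_invK !compA -assoc_bwd_natural.
rewrite -(compA (bwd _)) -tensM compm1 -thetaE.
have -> : w ⊗ₘ theta w = (idm _ ⊗ₘ theta w) ∘ (w ⊗ₘ idm _).
  by rewrite -tensM comp1m compm1.
by rewrite -!compA -thetaE.
Qed.

Lemma corep_iff_coaction (V : full_subcat P)
    (w : cohom L (V, proj1_sig V) ~> O) : is_corep w <-> is_coaction (theta w).
Proof.
have comulP : comul O ∘ w = (w ⊗ₘ w) ∘ coend_comul L V <->
    (idm O ⊗ₘ theta w) ∘ theta w
      = assoc _ _ _ ∘ (comul O ⊗ₘ idm _) ∘ theta w.
  split=> [wM | dA].
    rewrite -compA -theta_comp wM theta_tens_coend_comul !compA fwd_bwd.
    by rewrite comp1m.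
  apply: theta_inj; rewrite theta_tens_coend_comul theta_comp -compA dA.
  by rewrite !compA bwd_fwd comp1m.
have counitP : counit O ∘ w = coend_counit L V <->
    lunit _ ∘ (counit O ⊗ₘ idm _) ∘ theta w = idm _.
  split=> [w1 | d1].
    by rewrite -compA -theta_comp w1 /coend_counit theta_invK fwd_bwd.
  apply: theta_inj; rewrite theta_comp /coend_counit theta_invK.
  by apply: (iso_mono (e := lunit _)); rewrite compA d1 fwd_bwd.
by split=> -[hM h1]; split; [apply/comulP | apply/counitP
  | apply/comulP | apply/counitP].
Qed.

Lemma corep_mor_iff_coaction_mor (V V' : full_subcat P)
    (w : cohom L (V, proj1_sig V) ~> O) (w' : cohom L (V', proj1_sig V') ~> O)
    (f : V ~> V') :
  is_corep_mor w w' f <-> is_coaction_mor (theta w) (theta w') f.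
Proof.
have thetal : theta (w ∘ cohom_map L f (idm (proj1_sig V)))
    = (idm O ⊗ₘ f) ∘ theta w.
  by rewrite theta_cohom_mor compm1.
have thetar : theta (w' ∘ cohom_map L (idm V') (f : proj1_sig V ~> proj1_sig V'))
    = theta w' ∘ f.
  by rewrite theta_cohom_mor tens1 comp1m.
rewrite /is_corep_mor /is_coaction_mor -thetal -thetar.
by split=> [-> // | /theta_inj].
Qed.

(** * The functor induced by transposition *)

Lemma theta_coaction (V : full_subcat P) (w : cohom L (V, proj1_sig V) ~> O) :
  is_corep w -> is_coaction (theta w).
Proof. by move/corep_iff_coaction. Qed.

Lemma theta_coaction_mor (V V' : full_subcat P)
    (w : cohom L (V, proj1_sig V) ~> O) (w' : cohom L (V', proj1_sig V') ~> O)
    (f : V ~> V') :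
  is_corep w -> is_corep w' ->
  is_corep_mor w w' f -> is_coaction_mor (theta w) (theta w') f.
Proof. by move=> _ _ /corep_mor_iff_coaction_mor. Qed.

Definition corep_to_coaction : functor (Corep L O) (Lcoact O) :=
  theta_functor theta_coaction theta_coaction_mor.

Definition corep_mor_of_coaction_mor (A B : Corep L O)
    (f : corep_to_coaction A ~> corep_to_coaction B) : A ~> B :=
  exist _ (proj1_sig f)
    (proj2 (corep_mor_iff_coaction_mor _ _ (corep_map A) (corep_map B) _)
       (proj2_sig f)).

Lemma corep_to_coactionK (A B : Corep L O) :
  cancel (fun f : A ~> B => fmap corep_to_coaction f)
         (corep_mor_of_coaction_mor A B).
Proof. by move=> f; apply: sig_eq. Qed.

Lemma corep_mor_of_coaction_morK (A B : Corep L O) :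
  cancel (corep_mor_of_coaction_mor A B)
         (fun f : A ~> B => fmap corep_to_coaction f).
Proof. by move=> f; apply: sig_eq. Qed.

Lemma corep_to_coaction_fully_faithful : fully_faithful corep_to_coaction.
Proof.
move=> A B; exists (corep_mor_of_coaction_mor A B).
- exact: corep_to_coactionK.
- exact: corep_mor_of_coaction_morK.
Qed.

End Transposition.

(** * The coclosed case *)

Lemma idm_coaction_mor {C : symmonoidal} {O : comonoid C} {V : C}
    {d d' : V ~> O ⊗ V} : d = d' -> is_coaction_mor d d' (idm V).
Proof. by move=> ->; rewrite /is_coaction_mor tens1 comp1m compm1. Qed.

(** Equality of coactions on one object is turned into an isomorphism, as the
    corresponding objects of [Lcoact O] also carry proofs. *)
Program Definition coaction_iso {C : symmonoidal} {O : comonoid C} {V : C}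
    {d d' : V ~> O ⊗ V} (dP : is_coaction d) (dP' : is_coaction d')
    (dd' : d = d') : @iso (Lcoact O) (Coaction dP) (Coaction dP') :=
  @Iso (Lcoact O) (Coaction dP) (Coaction dP')
    (exist _ (idm V) (idm_coaction_mor dd'))
    (exist _ (idm V) (idm_coaction_mor (esym dd')))
    _ _.
Next Obligation. by move=> *; apply: sig_eq; rewrite /= comp1m. Qed.
Next Obligation. by move=> *; apply: sig_eq; rewrite /= comp1m. Qed.

Section Coclosed.

Context {C : symmonoidal} (O : comonoid C) (cc : coclosed C).

Let L := coclosed_adjoints cc.

Let full (V : C) : full_subcat (@whole C) := exist _ V I.

Lemma theta_inv_corep (A : coaction O) :
  is_corep (theta_inv L (Y := full (coact_ob A)) (coact A)).
Proof. by apply/corep_iff_coaction; rewrite theta_invK; apply: coactP. Qed.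

Definition corep_of_coaction (A : coaction O) : Corep L O :=
  Corepresentation (theta_inv_corep A).

Definition corep_of_coactionK (A : Lcoact O) :
    iso (corep_to_coaction O L (corep_of_coaction A)) A :=
  let: Coaction V d dP := A return
    iso (corep_to_coaction O L (corep_of_coaction A)) A in
  coaction_iso _ dP (theta_invK L (Y := full V) d).

Lemma Corep_equivalent_Lcoact : equivalent_cats (Corep L O) (Lcoact O).
Proof.
exact: (equivalent_of_split_ess_surj _ _ (corep_to_coaction O L) _
  (corep_to_coactionK O L) (corep_mor_of_coaction_morK O L)
  corep_of_coaction corep_of_coactionK).
Qed.

End Coclosed.

Theorem theorem3p8 (C : symmonoidal) (O : comonoid C) :
  (forall (P : C -> Prop)
      (L : forall V : full_subcat P, left_adjoint (tensr (proj1_sig V))),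
    (exists (h : forall (V : full_subcat P) (w : cohom L (V, proj1_sig V) ~> O),
               is_corep w -> is_coaction (theta w))
            (h' : forall (V V' : full_subcat P)
                    (w : cohom L (V, proj1_sig V) ~> O)
                    (w' : cohom L (V', proj1_sig V') ~> O) (f : V ~> V'),
                is_corep w -> is_corep w' ->
                is_corep_mor w w' f -> is_coaction_mor (theta w) (theta w') f),
       fully_faithful (theta_functor h h')) /\
    (forall (V : full_subcat P) (w : cohom L (V, proj1_sig V) ~> O),
       is_corep w <-> is_coaction (theta w)) /\
    (forall (V V' : full_subcat P) (w : cohom L (V, proj1_sig V) ~> O)
        (w' : cohom L (V', proj1_sig V') ~> O) (f : V ~> V'),
       is_corep w -> is_corep w' ->
       (is_corep_mor w w' f <-> is_coaction_mor (theta w) (theta w') f))) /\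
  (forall cc : coclosed C,
     equivalent_cats (Corep (coclosed_adjoints cc) O) (Lcoact O)).
Proof.
split=> [P L | cc]; last exact: Corep_equivalent_Lcoact.
split; last split.
- exists (theta_coaction O L), (theta_coaction_mor O L).
  exact: corep_to_coaction_fully_faithful.
- exact: corep_iff_coaction.
- move=> V V' w w' f _ _; exact: corep_mor_iff_coaction_mor.
Qed.
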